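(* Let $\mathbb X$ be a finite set and $P=\Delta_{\mathbb X}\cap\mathcal L$ with $\mathcal L\subseteq\mathbb R^{\mathbb X}$ an affine space and $P\cap\mathbb R^{\mathbb X}_{>0}\neq\emptyset$. Let $\mathbb R^p\to\operatorname{int}(P)$, $\theta\mapsto\mu_\theta$, be a differentiable parametrization, and let $f\colon\mathbb R^{\mathbb X}_{\ge0}\to\mathbb R$ be a continuous concave objective, differentiable on $\mathbb R^{\mathbb X}_{>0}$, which admits a maximizer $\mu^\star$ over $P$ with value $f^\star$. Write $f(\theta)=f(\mu_\theta)$. Let $(\theta_t)_{t\ge0}$ be a solution of the natural gradient flow $\partial_t\theta_t=F(\theta_t)^+\nabla f(\theta_t)$ and set $\mu_t:=\mu_{\theta_t}$. Then for all $t>0$ it holds that $$f^\star-f(\mu_t)\le\frac{D_{\mathrm{KL}}(\mu^\star,\mu_0)-D_{\mathrm{KL}}(\mu^\star,\mu_t)}{t}+t^{-1}\int_0^t\varepsilon_s\delta_s\,\mathrm ds,$$ where $\delta_t^2:=\chi^2(\mu^\star,\mu_t)$ and $\varepsilon_t^2:=\left\lVert\nabla^{\mathrm{FR}}_Pf(\mu_t)-\partial_t\mu_t\right\rVert^2_{g^{\mathrm{FR}}_{\mu_t}}$ (with $\delta_t,\varepsilon_t\ge0$), and $$\varepsilon_t^2\le\min_{w\in\mathbb R^p}\mathbb E_{\mu_t}\left[\left(w^\top\nabla_\theta\log\mu_{\theta_t}(x)-\nabla f(\mu_t)(x)\right)^2\right].$$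
   Context: $\Delta_{\mathbb X}=\{\mu\in\mathbb R^{\mathbb X}_{\ge0}:\sum_x\mu_x=1\}$ is the probability simplex. For a polytope $P$, $\operatorname{int}(P)$ is its relative interior and $TP$ the linear part of its affine hull. For $\mu,\nu\in\Delta_{\mathbb X}$ with $\nu_x=0\Rightarrow\mu_x=0$, $D_{\mathrm{KL}}(\mu,\nu)=\sum_x\mu_x\log\frac{\mu_x}{\nu_x}$ (with $0\log\frac00=0$). The $\chi^2$-divergence is $\chi^2(\mu,\nu)=\mathbb E_\nu\left[\frac{(\mu(x)-\nu(x))^2}{\nu(x)^2}\right]$. The Fisher-Rao metric is $g^{\mathrm{FR}}_\mu(v,w)=\sum_x\frac{v_xw_x}{\mu_x}$ for $\mu\in\mathbb R^{\mathbb X}_{>0}$, with norm $\lVert v\rVert_{g^{\mathrm{FR}}_\mu}=g^{\mathrm{FR}}_\mu(v,v)^{1/2}$. The Fisher-Rao gradient $\nabla^{\mathrm{FR}}_Pf(\mu)\in TP$ at $\mu\in\operatorname{int}(P)$ is determined by $g^{\mathrm{FR}}_\mu(\nabla^{\mathrm{FR}}_Pf(\mu),v)=\langle\nabla f(\mu),v\rangle$ for all $v\in TP$, where $\nabla f$ is the Euclidean gradient and $\nabla f(\mu)(x)$ its $x$-entry. The Fisher information matrix is $F(\theta)_{ij}=g^{\mathrm{FR}}_{\mu_\theta}(\partial_{\theta_i}\mu_\theta,\partial_{\theta_j}\mu_\theta)=\sum_x\frac{\partial_{\theta_i}\mu_\theta(x)\,\partial_{\theta_j}\mu_\theta(x)}{\mu_\theta(x)}$,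 and $F(\theta)^+$ is its Moore–Penrose pseudo-inverse; $\nabla f(\theta)$ is the gradient with respect to $\theta$. *)

(* Defs.v *)
From HB Require Import structures.
From mathcomp Require Import all_boot all_order all_algebra.
From mathcomp Require Import all_classical all_reals all_analysis.

Set Implicit Arguments.
Unset Strict Implicit.
Unset Printing Implicit Defensive.

Import Order.TTheory GRing.Theory Num.Theory.
Import numFieldNormedType.Exports.

Local Open Scope classical_set_scope.
Local Open Scope ring_scope.

Section Euclidean.
Context {R : realType}.

Definition dot n (u v : 'rV[R]_n) : R := \sum_i u 0 i * v 0 i.

Definition grad n (f : 'rV[R]_n -> R) (a : 'rV[R]_n) : 'rV[R]_n :=
  \row_i 'D_(delta_mx 0 i) f a.

Definition affine_space n (L : set 'rV[R]_n) : Prop :=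
  exists (a : 'rV[R]_n) (U : {vspace 'rV[R]_n}), L = [set a + u | u in [set` U]].

Definition affine_hull n (A : set 'rV[R]_n) : set 'rV[R]_n :=
  [set x | forall L, affine_space L -> A `<=` L -> L x].

Definition linear_part n (A : set 'rV[R]_n) : set 'rV[R]_n :=
  [set x - y | x in affine_hull A & y in affine_hull A].

(* interior in the subspace topology of the affine hull *)
Definition relint n (A : set 'rV[R]_n) : set 'rV[R]_n :=
  [set x | affine_hull A x /\
           \forall y \near within (affine_hull A) (nbhs x), A y].

Definition concave_on n (D : set 'rV[R]_n) (f : 'rV[R]_n -> R) : Prop :=
  @convex_function R 'rV[R]_n D (fun x => - f x).

Definition is_moore_penrose m n (A : 'M[R]_(m, n)) (B : 'M[R]_(n, m)) : Prop :=
  [/\ A *m B *m A = A, B *m A *m B = B,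
      (A *m B)^T = A *m B & (B *m A)^T = B *m A].

Definition mp_pinv m n (A : 'M[R]_(m, n)) : 'M[R]_(n, m) :=
  get [set B | is_moore_penrose A B].

(* Solutions on [0, +oo[; the derivative at the end point 0 is one-sided, and
   the values of theta at negative times are irrelevant. *)
Definition flow_solution n (b : 'rV[R]_n -> 'rV[R]_n) (theta : R -> 'rV[R]_n)
    : Prop :=
  (forall t : R, 0 < t -> is_derive t 1 theta (b (theta t))) /\
  (h^-1 *: (theta h - theta 0) @[h --> 0^'+] --> b (theta 0)).

End Euclidean.

(* R^X is represented by row vectors over the canonical enumeration of X, so as
   to use the library's norm and derivatives. *)
Notation vec R X := 'rV[R]_#|X|.

Section FisherRao.
Context {R : realType} {X : finType}.

Definition entry (v : vec R X) (x : X) : R := v 0 (enum_rank x).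

Definition orthant : set (vec R X) := [set v | forall x, 0 <= entry v x].

Definition pos_orthant : set (vec R X) := [set v | forall x, 0 < entry v x].

Definition simplex : set (vec R X) :=
  orthant `&` [set v | \sum_x entry v x = 1].

Definition expect (nu : vec R X) (h : X -> R) : R :=
  \sum_x entry nu x * h x.

(* Meant for nu x = 0 -> mu x = 0; the convention 0 * log (0 / 0) = 0 then
   follows from 0 * _ = 0. *)
Definition KL (mu nu : vec R X) : R :=
  \sum_x entry mu x * ln (entry mu x / entry nu x).

Definition chi2 (mu nu : vec R X) : R :=
  expect nu (fun x => (entry mu x - entry nu x) ^+ 2 / entry nu x ^+ 2).

Definition FRmetric (mu v w : vec R X) : R :=
  \sum_x entry v x * entry w x / entry mu x.

Definition FRnorm (mu v : vec R X) : R := Num.sqrt (FRmetric mu v v).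

Definition FRgrad (P : set (vec R X)) (f : vec R X -> R) (mu : vec R X)
    : vec R X :=
  get [set g | linear_part P g /\
    forall v, linear_part P v -> FRmetric mu g v = dot (grad f mu) v].

Definition fisher p (mu : 'rV[R]_p -> vec R X) (theta : 'rV[R]_p) : 'M[R]_p :=
  \matrix_(i, j) FRmetric (mu theta)
    ('D_(delta_mx 0 i) mu theta) ('D_(delta_mx 0 j) mu theta).

(* F(theta)^+ applied to the gradient; vectors are rows, whence the transpose *)
Definition natural_gradient p (mu : 'rV[R]_p -> vec R X) (f : vec R X -> R)
    (theta : 'rV[R]_p) : 'rV[R]_p :=
  grad (f \o mu) theta *m (mp_pinv (fisher mu theta))^T.

End FisherRao.

Arguments orthant R X : clear implicits.
Arguments pos_orthant R X : clear implicits.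
Arguments simplex R X : clear implicits.

(* Main.v *)
Require Import Defs.
From HB Require Import structures.
From mathcomp Require Import all_boot all_order all_algebra.
From mathcomp Require Import all_classical all_reals all_analysis.
From mathcomp Require Import measurable_realfun ring lra.

Set Implicit Arguments.
Unset Strict Implicit.
Unset Printing Implicit Defensive.

Import Order.TTheory GRing.Theory Num.Theory.
Import numFieldNormedType.Exports.

Local Open Scope classical_set_scope.
Local Open Scope ring_scope.

(** Write nu = mu_t and c = grad f(nu), let A be the Jacobian of the
    parametrization at theta_t and D the diagonal matrix of the 1/nu_x, so that
    the Fisher matrix is F = A D A^T. The row vector w0 = c A^T F^+ solves the
    normal equations w0 F = c A^T ([gram_pinv_projection]); hence the velocity
    V = w0 A of the flow is the Fisher-Rao orthogonal projection, onto the span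
    of the rows of A, of the unconstrained gradient [FRsharp nu c]. The fitting
    error of a parameter direction w is the squared Fisher-Rao distance from
    w A to [FRsharp nu c] ([error_residual]), so w0 minimizes it; and since
    [FRgrad P f nu] is the projection of [FRsharp nu c] onto the larger space TP,
    its distance to V is at most that minimum ([projection_le_residual]).

    For the convergence bound, the derivative of KL(mu*, mu_t) is - g(mu*, V) =
    - g(mu* - nu, V), because V has total mass zero. Splitting V into the
    gradient and a defect, concavity and the Cauchy-Schwarz inequality give
    KL' <= - (f* - f(mu_t)) + epsilon delta ([divergence_rate]). As f increases
    along the flow, integrating this over [0, t] yields the claim.

    The integration needs care: mu is only differentiable, and F^+ jumps where
    the rank of F drops, so V and epsilon need not be continuous. They are
    bounded on compact time intervals, however: both are at most the norm of
    [FRsharp nu c], and the partial derivatives of f stay bounded along the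
    path by concavity ([grad_bounded_along]). This makes the derivative of the
    divergence bounded, hence its integral equal to the increment by dominated
    convergence of difference quotients ([integral_bounded_derive]); the
    comparison with epsilon delta is then one of lower integrals
    ([increment_le_integral]). *)

(** * Integrals of bounded derivatives *)

Section IntegralOfDerivative.
Context {R : realType}.
Local Notation leb := (@lebesgue_measure R).

Lemma cvg_difference_quotient (g : R -> R) (x : R) (d : R ^nat) :
  derivable g x 1 -> (forall n, d n != 0) -> d n @[n --> \oo] --> 0 ->
  (d n)^-1 * (g (x + d n) - g x) @[n --> \oo] --> derive1 g x.
Proof.
move=> dg d0 dcv.
have dd : d n @[n --> \oo] --> 0^'.
  move=> A [e /= e0 eA].
  have /cvgrPdist_lt/(_ _ e0) := dcv; rewrite !near_simpl => H.
  by near=> n; apply: eA => //=; near: n.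
have := cvg_comp _ _ dd dg; rewrite -/(derive g x 1) -derive1E.
rewrite (_ : _ \o d = fun n => (d n)^-1 * (g (x + d n) - g x))//.
by apply/funext => n; rewrite /= [_%:A]mulr1 [d n + x]addrC.
Unshelve. all: by end_near. Qed.

Lemma derivable_is_derive1 (g : R -> R) (x : R) :
  derivable g x 1 -> is_derive x 1 g (derive1 g x).
Proof. by move=> dg; apply: DeriveDef dg _; rewrite derive1E. Qed.

(** The integral of a nonnegative function is the supremum of the integrals of
    the simple functions below it, so it is monotone on arbitrary functions. *)
Lemma le_integral_restrict d (T : measurableType d)
    (m : {measure set T -> \bar R}) (A B : set T) (f g : T -> \bar R) :
  (forall x, A x -> (0 <= f x)%E) -> (forall x, B x -> (0 <= g x)%E) ->
  (forall x, ((f \_ A) x <= (g \_ B) x)%E) ->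
  (\int[m]_(x in A) f x <= \int[m]_(x in B) g x)%E.
Proof.
move=> f0 g0 fg; rewrite !ge0_integralE//; apply: le_ereal_sup => _ [h hf <-].
by exists h => // x; exact: le_trans (hf x) (fg x).
Qed.

(** Dominated convergence of difference quotients, which the mean value theorem
    bounds by [M]. Each quotient of [k] is the derivative of the same quotient
    of a primitive [K] of [k], so its integral is a difference of two quotients
    of [K], which converges to [k b - k a]. *)
Lemma integral_bounded_derive (k : R -> R) (l a b r M : R) :
  l < a -> a < b -> b < r ->
  (forall x, l < x < r -> derivable k x 1) ->
  (forall x, l < x < r -> `|derive1 k x| <= M) ->
  leb.-integrable `[a, b] (EFin \o (derive1 k)) /\
  (\int[leb]_(x in `[a, b]) (derive1 k x)%:E = (k b - k a)%:E)%E.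
Proof.
move=> la ab br dk bk.
have kc x : l < x < r -> {for x, continuous k}.
  by move=> /dk/derivable1_diffP/differentiable_continuous.
pose l' := (l + a) / 2; pose r' := (b + r) / 2; pose u := (r' + r) / 2.
have ll' : l < l' by rewrite midf_lt.
have l'a : l' < a by rewrite midf_lt.
have br' : b < r' by rewrite midf_lt.
have r'r : r' < r by rewrite midf_lt.
have r'u : r' < u by rewrite midf_lt.
have ur : u < r by rewrite midf_lt.
pose K y := (\int[leb]_(t in `[l', y]) k t)%R.
have ik : leb.-integrable `[l', u] (EFin \o k).
  apply: continuous_compact_integrable; first exact: segment_compact.
  apply: derivable_within_continuous => x; rewrite in_itv/= => /andP[? ?].
  by apply: dk; lra.
have dK x : l' < x -> x <= r' -> derivable K x 1 /\ derive1 K x = k x.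
  move=> l'x xr'; apply: (@continuous_FTC1_closed R k l' x u) => //.
    exact: le_lt_trans r'u.
  by apply: kc; lra.
(* steps tending to 0 for which b + d n stays in the domain of K *)
pose d n : R := (r' - b) / n.+1%:R.
have d0 n : 0 < d n by rewrite divr_gt0// subr_gt0.
have dn0 n : d n != 0 by rewrite gt_eqF.
have dr n : d n <= r' - b.
  by rewrite ler_pdivrMr// ler_peMr// ?ler1n// subr_ge0 ltW.
have dcv : d n @[n --> \oo] --> 0.
  rewrite -(mulr0 (r' - b)); apply: cvgM; first exact: cvg_cst.
  exact: cvg_harmonic.
pose q n x := (d n)^-1 * (k (x + d n) - k x).
pose F n x := (d n)^-1 * (K (x + d n) - K x).
have shift_der (g : R -> R) n x : derivable g (x + d n) 1 ->
    is_derive x 1 (fun y => g (y + d n)) (derive1 g (x + d n)).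
  move=> dg.
  have h1 : is_derive x (1 : R) (fun y => y + d n) 1.
    have := is_deriveD (is_derive_id x (1 : R)) (is_derive_cst (d n) x (1 : R)).
    by rewrite addr0.
  have h2 := derivable_is_derive1 dg.
  have := @is_derive1_comp R g (fun y => y + d n) x _ _ h2 h1.
  by rewrite mulr1.
have dF n x : l' < x -> x <= b -> is_derive x 1 (F n) (q n x).
  move=> l'x xb.
  have [D1 E1] : derivable K (x + d n) 1 /\ derive1 K (x + d n) = k (x + d n).
    apply: dK; first by rewrite (lt_trans l'x)// ltrDl.
    by have := dr n; lra.
  have [D2 E2] : derivable K x 1 /\ derive1 K x = k x by apply: dK => //; lra.
  have i1 := shift_der _ _ _ D1; rewrite E1 in i1.
  have i2 := derivable_is_derive1 D2; rewrite E2 in i2.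
  have H := is_deriveZ (d n)^-1 (is_deriveB i1 i2).
  exact: H.
have dq n x : l < x -> x <= b -> derivable (q n) x 1.
  move=> l'x xb.
  have D1 : derivable k (x + d n) 1.
    by apply: dk; have := dr n; have := d0 n; lra.
  have D2 : derivable k x 1 by apply: dk; lra.
  have i1 := shift_der _ _ _ D1.
  have i2 := derivable_is_derive1 D2.
  have H := is_deriveZ (d n)^-1 (is_deriveB i1 i2).
  by case: H.
have cq n : {within `[a, b], continuous (q n)}.
  apply: derivable_within_continuous => x; rewrite in_itv/= => /andP[? ?].
  by apply: dq => //; lra.
have Iq n : (\int[leb]_(x in `[a, b]) (q n x)%:E = (F n b - F n a)%:E)%E.
  rewrite (@continuous_FTC2 _ (q n) (F n))//.
    have Fc x : l' < x -> x <= b -> {for x, continuous (F n)}.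
      move=> h1 h2; apply/differentiable_continuous/derivable1_diffP.
      by have [] := dF n _ h1 h2.
    split.
    - move=> x; rewrite in_itv/= => /andP[? ?].
      have l'x : l' < x by lra.
      have xb : x <= b by lra.
      by have [] := dF n _ l'x xb.
    - by apply: cvg_at_right_filter; apply: Fc => //; lra.
    - by apply: cvg_at_left_filter; apply: Fc => //; lra.
  move=> x; rewrite in_itv/= => /andP[? ?].
  have l'x : l' < x by lra.
  have xb : x <= b by lra.
  by have [_] := dF n _ l'x xb; rewrite derive1E.
have qk x : `[a, b]%classic x -> q n x @[n --> \oo] --> derive1 k x.
  rewrite /= in_itv/= => /andP[? ?].
  by apply: cvg_difference_quotient => //; apply: dk; lra.
have qM n x : `[a, b]%classic x -> `|q n x| <= M.
  rewrite /= in_itv/= => /andP[? ?].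
  have [c] : exists2 c, c \in `]x, x + d n[ &
      k (x + d n) - k x = derive1 k c * (x + d n - x).
    have [? ?] := (dr n, d0 n).
    apply: MVT; first by rewrite ltrDl.
      move=> y; rewrite in_itv/= => /andP[? ?].
      by apply: derivable_is_derive1; apply: dk; lra.
    apply: derivable_within_continuous => y; rewrite in_itv/= => /andP[? ?].
    by apply: dk; lra.
  rewrite in_itv/= => /andP[? ?]; rewrite /q => ->.
  rewrite [x + _]addrC addrK mulrCA mulVf// mulr1; apply: bk.
  by have := dr n; lra.
have mI : measurable (`[a, b] : set (measurableTypeR R)) by [].
have mq n : measurable_fun (`[a, b] : set (measurableTypeR R)) (q n).
  have /measurable_int/measurable_EFinP := @continuous_compact_integrable _ _ _
    (@segment_compact _ a b) (cq n).
  exact.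
have mk : measurable_fun (`[a, b] : set (measurableTypeR R)) (derive1 k).
  exact: (@measurable_fun_cvg _ _ _ _ q).
have iM : leb.-integrable `[a, b] (EFin \o cst M).
  apply: measurable_bounded_integrable => //.
    by rewrite /= lebesgue_measure_itv/= lte_fin ab -EFinB ltry.
  exact: bounded_cst.
have [] := @dominated_convergence _ _ _ leb `[a, b] mI
  (fun n => EFin \o q n) (EFin \o (derive1 k)) (EFin \o cst M).
- by move=> n; apply/measurable_EFinP.
- exact/measurable_EFinP.
- by apply: aeW => x xab; apply: cvg_EFin; [exact: nearW|exact: qk].
- exact: iM.
- by apply: aeW => x n xab /=; rewrite lee_fin qM.
move=> ik' _ Hcv; split => //.
have FF : F n b - F n a @[n --> \oo] --> k b - k a.
  have [D1 E1] := dK _ l'a (ltW (lt_trans ab br')).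
  have [D2 E2] := dK _ (lt_trans l'a ab) (ltW br').
  have C1 := cvg_difference_quotient D1 dn0 dcv; rewrite E1 in C1.
  have C2 := cvg_difference_quotient D2 dn0 dcv; rewrite E2 in C2.
  exact: cvgB C2 C1.
have FE : (fun n => (F n b - F n a)%:E) @ \oo --> (k b - k a)%:E.
  by apply: cvg_EFin; [exact: nearW|exact: FF].
apply: cvg_unique FE => //; rewrite -[X in X @ _](_ : (fun n =>
  \int[leb]_(x in `[a, b]) (q n x)%:E)%E = _); first exact: Hcv.
by apply/funext => n; rewrite Iq.
Qed.

(** [u] may fail to be measurable; its integral is then a lower integral, finite
    by boundedness, which dominates the integral of the positive part of the
    derivative. The differentiability at 0 is replaced by a limit of the
    inequality over [a, t] as a decreases to 0. *)
Lemma increment_le_integral (phi u : R -> R) (t M : R) : 0 < t ->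
  phi x @[x --> 0^'+] --> phi 0 ->
  (forall s, 0 < s -> derivable phi s 1) ->
  (forall s, 0 < s < t + 1 -> `|derive1 phi s| <= M) ->
  (forall s, 0 <= u s) ->
  (forall s, 0 < s <= t -> derive1 phi s <= u s) ->
  (forall s, 0 < s <= t -> u s <= M) ->
  phi t - phi 0 <= \int[leb]_(s in `[0, t]) u s.
Proof.
move=> t0 phi0 dphi bphi u0 phiu uM.
have M0 : 0 <= M by apply: le_trans (uM t _) => //; rewrite t0 lexx.
have mI : measurable (`[0, t] : set (measurableTypeR R)) by [].
(* u 0 is not bounded by M, hence the constant M + u 0 *)
have fin_u : (\int[leb]_(s in `[0%R, t]) (u s)%:E)%E \is a fin_num.
  rewrite ge0_fin_numE; last by apply: integral_ge0 => s _; rewrite lee_fin.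
  apply: (@le_lt_trans _ _ (\int[leb]_(s in `[0%R, t]) (M + u 0%R)%:E)%E).
    apply: le_integral_restrict => [s _|s _|s]; rewrite ?lee_fin ?addr_ge0//.
    rewrite !patchE; case: ifPn => //; rewrite inE/= in_itv/= lee_fin.
    rewrite le_eqVlt => /andP[/predU1P[<-|s0] st]; first by rewrite lerDr.
    by rewrite (le_trans (uM s _)) ?s0// lerDl.
  rewrite integral_cst//= lebesgue_measure_itv/= lte_fin t0 -EFinB -EFinM.
  exact: ltry.
have incr a : 0 < a < t -> phi t - phi a <= \int[leb]_(s in `[0, t]) u s.
  move=> /andP[a0 at_].
  have tt1 : t < t + 1 by rewrite ltrDl.
  have [_ Ephi] := integral_bounded_derive a0 at_ tt1
    (fun x h => dphi x (proj1 (andP h))) bphi.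
  rewrite -lee_fin /Rintegral fineK// -Ephi.
  rewrite [leLHS]integralE; apply: (@le_trans _ _
    (\int[leb]_(x in `[a, t]) ((fun x => (derive1 phi x)%:E)^\+ x))%E).
    by rewrite -[leRHS]sube0; apply: leeB => //; apply: integral_ge0.
  apply: le_integral_restrict => [s _|s _|s] //; first by rewrite lee_fin.
  rewrite !patchE; case: ifPn => [|_]; last first.
    by case: ifPn => // _; rewrite lee_fin.
  rewrite inE/= in_itv/= => /andP[as_ st]; have s0 : 0 < s by exact: lt_le_trans as_.
  rewrite ifT; last by rewrite inE/= in_itv/= (ltW s0).
  by rewrite funeposE ge_max lee_fin phiu ?s0//= lee_fin.
rewrite lerBlDr -lerBlDl.
apply: (@closed_cvg _ _ _ _ phi [set y | phi t - \int[leb]_(s in `[0, t]) u s <= y] _ _ _ phi0).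
  exact: closed_ge.
near=> a; rewrite /= lerBlDr -lerBlDl; apply: incr; apply/andP; split.
  by near: a; exact: nbhs_right_gt.
by near: a; exact: nbhs_right_lt.
Unshelve. all: by end_near. Qed.

End IntegralOfDerivative.

(** * Moore-Penrose inverses of real matrices *)

Section MoorePenrose.
Context {R : realType}.

Lemma row_mul_tr n (u v : 'rV[R]_n) : (u *m v^T) 0 0 = dot u v.
Proof. by rewrite mxE; apply: eq_bigr => i _; rewrite mxE. Qed.

Lemma dot_eq0 n (u : 'rV[R]_n) : dot u u = 0 -> u = 0.
Proof.
move=> /eqP; rewrite psumr_eq0 => [/allP u0|i _]; last by rewrite -expr2 sqr_ge0.
apply/rowP => i; have := u0 i (mem_index_enum _).
by rewrite mulf_eq0 orbb mxE => /eqP.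
Qed.

Lemma gram_unit m n (B : 'M[R]_(m, n)) : row_free B -> B *m B^T \in unitmx.
Proof.
move=> freeB; rewrite -row_free_unit; apply: inj_row_free => v vBB.
apply: (row_free_inj freeB); rewrite mul0mx; apply: dot_eq0.
by rewrite -row_mul_tr trmx_mul mulmxA -(mulmxA v) vBB mul0mx mxE.
Qed.

(** With G = E E^T and H = C^T C, both invertible by full rank, the two products
    of the factors are the symmetric matrices C H^-1 C^T and E^T G^-1 E. *)
Lemma moore_penrose_full_rank m r n (C : 'M[R]_(m, r)) (E : 'M[R]_(r, n)) :
  row_free C^T -> row_free E ->
  is_moore_penrose (C *m E)
    (E^T *m invmx (E *m E^T) *m invmx (C^T *m C) *m C^T).
Proof.
move=> freeC freeE; pose G := E *m E^T; pose H := C^T *m C.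
have uG : G \in unitmx by exact: gram_unit.
have uH : H \in unitmx by rewrite /H -[X in _ *m X]trmxK gram_unit.
rewrite -/G -/H; set A := C *m E; set B := _ *m C^T.
have symG : G^T = G by rewrite trmx_mul trmxK.
have symH : H^T = H by rewrite trmx_mul trmxK.
have AB : A *m B = C *m invmx H *m C^T.
  by rewrite /B /A !mulmxA -(mulmxA C) -/G -(mulmxA C) mulmxV// mulmx1.
have BA : B *m A = E^T *m invmx G *m E.
  rewrite /B /A !mulmxA -(mulmxA _ C^T) -/H -(mulmxA _ (invmx H)).
  by rewrite mulVmx// mulmx1.
split.
- by rewrite AB /A !mulmxA -(mulmxA _ C^T) -/H -(mulmxA C) mulVmx// mulmx1.
- rewrite BA /B !mulmxA -(mulmxA _ E) -/G -(mulmxA _ (invmx G) G).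
  by rewrite mulVmx// mulmx1.
- by rewrite AB !trmx_mul trmxK trmx_inv symH mulmxA.
- by rewrite BA !trmx_mul trmxK trmx_inv symG mulmxA.
Qed.

Lemma moore_penrose_exists m n (A : 'M[R]_(m, n)) :
  exists B, is_moore_penrose A B.
Proof.
have := @moore_penrose_full_rank _ _ _ (col_base A) (row_base A).
rewrite mulmx_base /row_free mxrank_tr.
move=> H; eexists; apply: H; first exact: col_base_full.
exact: row_base_free.
Qed.

Lemma mp_pinvP m n (A : 'M[R]_(m, n)) : is_moore_penrose A (mp_pinv A).
Proof. by have [B AB] := moore_penrose_exists A; exact: (getPex (ex_intro _ B AB)). Qed.

End MoorePenrose.

(** * The Fisher-Rao form and the normal equations *)

Section FisherRaoForm.
Context {R : realType} {X : finType}.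
Implicit Types (nu v w g : vec R X).

Lemma sum_entry (F : 'I_#|X| -> R) : \sum_(x : X) F (enum_rank x) = \sum_i F i.
Proof.
rewrite (reindex (@enum_rank X))//.
by apply: onW_bij; exact: enum_rank_bij.
Qed.

Lemma FRmetricE nu v w : FRmetric nu v w = \sum_i v 0 i * w 0 i / nu 0 i.
Proof. by rewrite -sum_entry. Qed.

Lemma pos_orthantE nu : pos_orthant R X nu -> forall i, 0 < nu 0 i.
Proof. by move=> nu0 i; have := nu0 (enum_val i); rewrite /entry enum_valK. Qed.

Lemma FRmetricC nu v w : FRmetric nu v w = FRmetric nu w v.
Proof. by apply: eq_bigr => x _; rewrite [_ * entry w x]mulrC. Qed.

Lemma FRmetricDl nu v1 v2 w :
  FRmetric nu (v1 + v2) w = FRmetric nu v1 w + FRmetric nu v2 w.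
Proof.
by rewrite !FRmetricE -big_split; apply: eq_bigr => i _ /=; rewrite mxE !mulrDl.
Qed.

Lemma FRmetricNl nu v w : FRmetric nu (- v) w = - FRmetric nu v w.
Proof.
by rewrite !FRmetricE -sumrN; apply: eq_bigr => i _ /=; rewrite mxE !mulNr.
Qed.

Lemma FRmetricBl nu v1 v2 w :
  FRmetric nu (v1 - v2) w = FRmetric nu v1 w - FRmetric nu v2 w.
Proof. by rewrite FRmetricDl FRmetricNl. Qed.

Lemma FRmetricBr nu v w1 w2 :
  FRmetric nu v (w1 - w2) = FRmetric nu v w1 - FRmetric nu v w2.
Proof. by rewrite ![FRmetric nu v _]FRmetricC FRmetricBl. Qed.

Lemma FRmetricDr nu v w1 w2 :
  FRmetric nu v (w1 + w2) = FRmetric nu v w1 + FRmetric nu v w2.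
Proof. by rewrite ![FRmetric nu v _]FRmetricC FRmetricDl. Qed.

Lemma FRmetricZl nu a v w : FRmetric nu (a *: v) w = a * FRmetric nu v w.
Proof.
by rewrite !FRmetricE mulr_sumr; apply: eq_bigr => i _; rewrite mxE !mulrA.
Qed.

Lemma FRmetric_ge0 nu v : pos_orthant R X nu -> 0 <= FRmetric nu v v.
Proof.
move=> nu0; apply: sumr_ge0 => x _.
by rewrite divr_ge0 -?expr2 ?sqr_ge0// ltW.
Qed.

Lemma FRmetric_eq0 nu v : pos_orthant R X nu -> FRmetric nu v v = 0 -> v = 0.
Proof.
move=> nu0 /eqP; rewrite FRmetricE psumr_eq0 => [/allP v0|i _]; last first.
  by rewrite divr_ge0 -?expr2 ?sqr_ge0// ltW// pos_orthantE.
apply/rowP => i; have := v0 i (mem_index_enum _).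
by rewrite !mulf_eq0 orbb invr_eq0 (gt_eqF (pos_orthantE nu0 i)) orbF mxE => /eqP.
Qed.

Definition FRdiag nu : 'M[R]_#|X| := diag_mx (\row_i (nu 0 i)^-1).

Lemma FRmetric_mx nu v w : FRmetric nu v w = (v *m FRdiag nu *m w^T) 0 0.
Proof.
rewrite FRmetricE mxE; apply: eq_bigr => i _.
by rewrite mul_mx_diag !mxE mulrAC.
Qed.

(** The row vector g A^T (S^+)^T, for S the Gram matrix A D A^T, solves the
    normal equations: the identity S S^+ S = S says that N = 1 - S S^+ satisfies
    N A D (N A)^T = 0, hence N A = 0 as D is positive definite. *)
Lemma gram_pinv_projection nu p (A : 'M[R]_(p, #|X|)) g (u : 'rV[R]_p) :
  pos_orthant R X nu ->
  FRmetric nu (g *m A^T *m (mp_pinv (A *m FRdiag nu *m A^T))^T *m A) (u *m A)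
  = dot g (u *m A).
Proof.
move=> nu0; set S := A *m _ *m _; set B := mp_pinv S.
have [SBS _ _ _] : is_moore_penrose S B := mp_pinvP S.
have symS : S^T = S by rewrite !trmx_mul trmxK /FRdiag tr_diag_mx mulmxA.
have SBA : S *m B *m A = A.
  apply/eqP; rewrite -subr_eq0 -opprB oppr_eq0; apply/eqP.
  rewrite -{1}[A]mul1mx -mulmxBl; set N := 1%:M - _.
  have NS : N *m S = 0 by rewrite mulmxBl mul1mx SBS subrr.
  apply/row_matrixP => i; rewrite row0; apply: (FRmetric_eq0 nu0).
  rewrite FRmetric_mx rowE trmx_mul -!mulmxA trmx_mul.
  rewrite [A *m (_ *m _)](_ : _ = S *m (N^T *m (delta_mx 0 i)^T)).
    by rewrite (mulmxA N) NS mul0mx mulmx0 mxE.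
  by rewrite !mulmxA.
have ABS : A^T *m B^T *m S = A^T.
  by rewrite -[S]symS -!trmx_mul mulmxA SBA.
rewrite FRmetric_mx -row_mul_tr [(u *m A)^T]trmx_mul -[in RHS]ABS.
by rewrite /S !mulmxA.
Qed.

End FisherRaoForm.

(** * Polytopes cut out of the simplex *)

Section Polytope.
Context {R : realType} {X : finType}.
Implicit Types (nu v w g q d : vec R X).

Lemma entryD v w x : entry (v + w) x = entry v x + entry w x.
Proof. by rewrite /entry mxE. Qed.

Lemma entryN v x : entry (- v) x = - entry v x.
Proof. by rewrite /entry mxE. Qed.

Lemma entryB v w x : entry (v - w) x = entry v x - entry w x.
Proof. by rewrite entryD entryN. Qed.

Lemma entryZ (a : R) v x : entry (a *: v) x = a * entry v x.
Proof. by rewrite /entry mxE. Qed.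

Definition entryE := (entryB, entryD, entryN, entryZ).

(** The step 1 / (1 + S), with S the sum of the ratios of the absolute entries of
    d to those of q, keeps every entry of the displacement below that of q. *)
Lemma pos_orthant_move q d : pos_orthant R X q ->
  exists2 e : R, 0 < e & orthant R X (q + e *: d).
Proof.
move=> q0; pose S := \sum_x `|entry d x| / entry q x.
have S0 : 0 <= S by apply: sumr_ge0 => x _; rewrite divr_ge0// ltW.
have S1 : 0 < 1 + S by rewrite ltr_pwDl.
exists (1 + S)^-1; first by rewrite invr_gt0.
move=> x; rewrite !entryE.
have dS : `|entry d x| <= (1 + S) * entry q x.
  rewrite -ler_pdivrMr//; apply: (@le_trans _ _ S); last by rewrite lerDr.
  rewrite /S (bigD1 x)//= lerDl; apply: sumr_ge0 => y _.
  by rewrite divr_ge0// ltW.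
have : - ((1 + S) * entry q x) <= entry d x by rewrite lerNl (le_trans _ dS)// -normrN ler_norm.
rewrite -subr_ge0 opprK => h.
rewrite -(pmulr_rge0 _ S1) mulrDr mulrA mulfV ?gt_eqF// mul1r.
by rewrite addrC.
Qed.

(** A point of P in the open orthant makes only the equalities matter: the
    affine hull is cut out by the direction of L and by the constancy of the
    total mass. *)
Lemma affine_hull_polytope (L P : set (vec R X)) q :
  affine_space L -> P = simplex R X `&` L -> P q -> pos_orthant R X q ->
  exists U : {vspace vec R X},
    (forall v, v \in U -> \sum_x entry v x = 0) /\
    (forall x, affine_hull P x <-> x - q \in U).
Proof.
move=> [a [W LE]] PE Pq q0.
pose s : 'Hom(vec R X, 'rV[R]_1) := linfun (mulmxr (const_mx 1)).
have sE v : (s v) 0 0 = \sum_x entry v x.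
  rewrite lfunE/= mxE (sum_entry (fun i => v 0 i)).
  by apply: eq_bigr => i _; rewrite mxE mulr1.
have kerP v : reflect (\sum_x entry v x = 0) (v \in lker s).
  rewrite memv_ker -sE; apply: (iffP eqP) => [->|h]; first by rewrite mxE.
  by apply/rowP => i; rewrite ord1 h mxE.
have [[q_ge0 q1] Lq] : (simplex R X `&` L) q by rewrite -PE.
have LW x : L x <-> x - q \in W.
  move: Lq; rewrite LE => -[u uW uq]; split=> [[v vW <-]|xqW].
    by rewrite -uq opprD addrACA subrr add0r memvB.
  exists (x - q + u); first exact: memvD.
  by rewrite addrCA uq subrK.
pose U := (W :&: lker s)%VS.
exists U; split=> [v|x].
  by rewrite memv_cap => /andP[_ /kerP].
split=> [xU|xU A [b [V AE]] PA].
  suff [u /= uU <-] : [set q + u | u in [set` U]] x by rewrite addrC addKr.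
  apply: xU; first by exists q, U.
  move=> y; rewrite PE => -[[_ y1] /LW yW]; exists (y - q); last by rewrite subrKC.
  rewrite /= memv_cap yW; apply/kerP.
  by under eq_bigr do rewrite entryB; rewrite sumrB y1 q1 subrr.
move: xU; rewrite memv_cap => /andP[xW /kerP x0].
have [e e0 he] := pos_orthant_move (x - q) q0.
have Py : P (q + e *: (x - q)).
  rewrite PE; split; last by apply/LW; rewrite addrC addKr memvZ.
  split=> //=; under eq_bigr do rewrite entryD entryZ.
  by rewrite big_split/= -mulr_sumr x0 mulr0 addr0.
have := PA _ Py; have := PA _ Pq; rewrite AE => -[u1 u1V E1] [u2 u2V E2].
have dV : x - q \in V.
  rewrite -[x - q]scale1r -(mulVf (lt0r_neq0 e0)) -scalerA memvZ//.
  have -> : e *: (x - q) = u2 - u1; last exact: memvB.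
  have -> : e *: (x - q) = (q + e *: (x - q)) - q by rewrite addrAC subrr add0r.
  by rewrite -E2 -E1 opprD addrACA subrr add0r.
by exists (u1 + (x - q)); [exact: memvD|rewrite addrA E1 subrKC].
Qed.

Lemma linear_part_polytope (P : set (vec R X)) q (U : {vspace vec R X}) :
  (forall x, affine_hull P x <-> x - q \in U) ->
  forall v, linear_part P v <-> v \in U.
Proof.
move=> hullP v; split=> [[x /hullP xU [y /hullP yU <-]]|vU].
  by rewrite -(subrKA q) -[X in _ + X]opprB memvB.
exists (q + v); first by apply/hullP; rewrite addrC addKr.
by exists q; [apply/hullP; rewrite subrr mem0v|rewrite addrC addKr].
Qed.

(** A relative interior point can be moved a little away from q inside P; if
    one of its entries vanished, that entry would become negative. *)
Lemma relint_pos (P : set (vec R X)) q (U : {vspace vec R X}) nu :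
  P `<=` orthant R X -> pos_orthant R X q ->
  (forall x, affine_hull P x <-> x - q \in U) ->
  relint P nu -> P nu /\ pos_orthant R X nu.
Proof.
move=> Porth q0 hullP [hnu nearP]; split; first exact: (nbhs_singleton nearP).
have cv : nu + e *: (nu - q) @[e --> (0 : R)] --> nu.
  have : nu + e *: (nu - q) @[e --> (0 : R)] --> nu + 0 *: (nu - q).
    apply: cvgD; first exact: cvg_cst.
    by apply: cvgZr_tmp; exact: cvg_id.
  by rewrite scale0r addr0.
have {}nearP : \forall e \near 0^'+, P (nu + e *: (nu - q)).
  have /cvg_at_right_filter cvr := cv.
  have := cvr _ nearP; rewrite /= !near_simpl/=; apply: filterS => e; apply.
  apply/hullP; rewrite addrAC -{1}[nu - q]scale1r -scalerDl memvZ//.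
  exact/hullP.
have [e [e0 Pe]] : exists e : R, 0 < e /\ P (nu + e *: (nu - q)).
  near (0 : R)^'+ => e; exists e; split; first by near: e; exact: nbhs_right_gt.
  by near: e.
move=> x; have := Porth _ Pe x; rewrite !entryE => h.
have := q0 x; nra.
Unshelve. all: by end_near. Qed.

(** A Riesz representation, obtained from the normal equations for a basis of
    the linear part. *)
Lemma FRgradP (P : set (vec R X)) (U : {vspace vec R X}) (f : vec R X -> R) nu :
  (forall v, linear_part P v <-> v \in U) -> pos_orthant R X nu ->
  FRgrad P f nu \in U /\
  forall v, v \in U -> FRmetric nu (FRgrad P f nu) v = dot (grad f nu) v.
Proof.
move=> linP nu0; pose A := \matrix_i (tnth (vbasis U) i).
have AU u : u *m A \in U.
  rewrite mulmx_sum_row; apply: memv_suml => i _; apply: memvZ.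
  by rewrite rowK; apply: vbasis_mem; exact: mem_tnth.
have inA v : v \in U -> exists u, v = u *m A.
  move=> vU; exists (\row_i coord (vbasis U) i v); rewrite mulmx_sum_row.
  rewrite {1}(coord_vbasis vU); apply: eq_bigr => i _.
  by rewrite mxE rowK (tnth_nth 0).
have [g gU gE] : exists2 g, g \in U &
    forall v, v \in U -> FRmetric nu g v = dot (grad f nu) v.
  pose w := grad f nu *m A^T *m (mp_pinv (A *m FRdiag nu *m A^T))^T.
  exists (w *m A); first exact: AU.
  by move=> _ /inA[u ->]; exact: gram_pinv_projection.
have [/linP] := getPex (ex_intro (fun g => linear_part P g /\
  forall v, linear_part P v -> FRmetric nu g v = dot (grad f nu) v) g
  (conj (proj2 (linP g) gU) (fun v vP => gE v (proj1 (linP v) vP)))).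
by move=> ? h; split=> // v /linP; exact: h.
Qed.

End Polytope.

(** * Gradients and directional derivatives *)

Section EuclideanCalculus.
Context {R : realType}.

(** The inner product with a fixed vector, in a form that carries the structure
    of a linear map. *)
Definition dotr n (c w : 'rV[R]_n) : R^o := dot w c.

Lemma dotr_linear n (c : 'rV[R]_n) : linear (dotr c).
Proof.
move=> a u v; rewrite /dotr /dot scaler_sumr -big_split.
by apply: eq_bigr => i _; rewrite !mxE mulrDl -mulrA.
Qed.

HB.instance Definition _ n (c : 'rV[R]_n) :=
  GRing.isLinear.Build R 'rV[R]_n R^o _ (dotr c) (dotr_linear c).

Lemma dotr_continuous n (c : 'rV[R]_n) : continuous (dotr c).
Proof.
move=> w; apply: differentiable_continuous.
rewrite (_ : dotr c = \sum_i (fun w : 'rV[R]_n => w 0 i * c 0 i)); last first.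
  by apply/funext => v; rewrite fct_sumE.
apply: differentiable_sum => i; apply: differentiableM => //.
exact: differentiable_coord.
Qed.

Lemma dotr_differentiable n (c w : 'rV[R]_n) : differentiable (dotr c) w.
Proof. exact/linear_differentiable/dotr_continuous. Qed.

Lemma derive_dotr n (c a v : 'rV[R]_n) : 'D_v (dotr c) a = dot v c.
Proof.
rewrite deriveE; last exact: dotr_differentiable.
by rewrite diff_lin//; exact: dotr_continuous.
Qed.

Lemma derive_chain (V1 V2 V3 : normedModType R) (f : V1 -> V2) (g : V2 -> V3)
    a v : differentiable f a -> differentiable g (f a) ->
  'D_v (g \o f) a = 'D_('D_v f a) g (f a).
Proof.
move=> df dg; rewrite !deriveE//; last exact: differentiable_comp.
by rewrite diff_comp.
Qed.

Lemma derive_dotr_comp (V : normedModType R) n (c : 'rV[R]_n)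
    (g : V -> 'rV[R]_n) a v :
  differentiable g a -> 'D_v (dotr c \o g) a = dotr c ('D_v g a).
Proof.
move=> dg.
have := @derive_chain V _ R^o g (dotr c) a v dg (dotr_differentiable c (g a)).
by rewrite derive_dotr.
Qed.

Lemma derive_dot_grad n (f : 'rV[R]_n -> R) (a v : 'rV[R]_n) :
  differentiable f a -> 'D_v f a = dot (grad f a) v.
Proof.
move=> df; rewrite deriveE// {1}(row_sum_delta v) linear_sum.
apply: eq_bigr => i _; rewrite linearZ mxE deriveE//.
exact: mulrC.
Qed.

Lemma grad_comp m n (f : 'rV[R]_n -> R) (g : 'rV[R]_m -> 'rV[R]_n) a :
  differentiable g a -> differentiable f (g a) ->
  grad (f \o g) a = grad f (g a) *m (jacobian g a)^T.
Proof.
move=> dg df; apply/rowP => i; rewrite !mxE derive_chain// derive_dot_grad//.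
apply: eq_bigr => j _; rewrite deriveEjacobian// -rowE.
by rewrite !mxE.
Qed.

(** A subspace is cut out by finitely many continuous linear forms, each
    constant along g. *)
Lemma derive_in_subspace m n (U : {vspace 'rV[R]_n})
    (g : 'rV[R]_m -> 'rV[R]_n) a v :
  differentiable g a -> (forall x y, g x - g y \in U) -> 'D_v g a \in U.
Proof.
move=> dg gU; pose h : 'End('rV[R]_n) := (\1 - projv U)%VF.
have hU w : (w \in U) = (h w == 0).
  apply/idP/eqP => [wU|]; rewrite /h add_lfunE opp_lfunE id_lfunE.
    by rewrite projv_id// subrr.
  by move/eqP; rewrite subr_eq0 => /eqP ->; exact: memv_proj.
have hE w j : (h w) 0 j = dotr (\row_i (h (delta_mx 0 i)) 0 j) w.
  rewrite {1}(row_sum_delta w) linear_sum summxE; apply: eq_bigr => i _.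
  by rewrite linearZ !mxE.
rewrite hU; apply/eqP/rowP => j; rewrite hE [RHS]mxE.
set c := \row_i _; have -> : dotr c ('D_v g a) = 'D_v (dotr c \o g) a.
  by rewrite derive_dotr_comp.
rewrite (_ : dotr c \o g = cst (dotr c (g a))) ?derive_cst//.
apply/funext => x /=; apply/eqP; rewrite -subr_eq0.
have /= <- := linearB (dotr c) (g x) (g a).
have := hE (g x - g a) j; rewrite -/c => <-.
by have := gU x a; rewrite hU => /eqP ->; rewrite mxE.
Qed.

(** The difference quotients at x in the direction y - x all lie above
    f y - f x by concavity. *)
Lemma concave_le_grad n (D : set 'rV[R]_n) (f : 'rV[R]_n -> R) x y :
  concave_on D f -> D x -> D y -> differentiable f x ->
  f y - f x <= dot (grad f x) (y - x).
Proof.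
move=> fD Dx Dy df; rewrite -derive_dot_grad//.
have dvl : derivable f x (y - x) by exact: diff_derivable.
have /cvg_dnbhs_at_right cvr : h^-1 *: (f (h *: (y - x) + x) - f x) @[h --> 0^'] -->
  'D_(y - x) f x by exact: dvl.
apply: (@closed_cvg _ _ _ _ _ [set r | f y - f x <= r] _ _ _ cvr).
  exact: closed_ge.
near=> h; rewrite /=.
have h0 : 0 < h by near: h; exact: nbhs_right_gt.
have h1 : h <= 1 by near: h; exact: nbhs_right_le.
have hi : Itv.spec (@Itv.num_sem R) (Itv.Real `[0%Z, 1%Z]%O) h.
  by rewrite /= /Itv.num_sem/= in_itv/= ger0_real ?(ltW h0).
pose t : {i01 R} := Itv.mk hi.
have := fD t y x; rewrite !inE => /(_ Dy Dx); rewrite convRE /conv/= /unstable.onem.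
have -> : h *: y + (1 - h) *: x = h *: (y - x) + x.
  by rewrite scalerBl scale1r scalerBr addrCA addrC.
move=> H; rewrite -[leRHS]/(h^-1 * _) mulrC ler_pdivlMr//.
lra.
Unshelve. all: by end_near. Qed.

End EuclideanCalculus.

(** * Orthogonal projection in the Fisher-Rao form *)

Section FisherRaoProjection.
Context {R : realType} {X : finType}.
Implicit Types (nu v w a b c : vec R X).

(** The Fisher-Rao gradient without any affine constraint. *)
Definition FRsharp nu c : vec R X := \row_i (nu 0 i * c 0 i).

Lemma FRmetric_sharp nu c v :
  pos_orthant R X nu -> FRmetric nu (FRsharp nu c) v = dot c v.
Proof.
move=> nu0; rewrite FRmetricE; apply: eq_bigr => i _; rewrite mxE.
by field; rewrite gt_eqF// pos_orthantE.
Qed.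

Lemma FRmetric_pythagoras nu a b : FRmetric nu a b = 0 ->
  FRmetric nu (a + b) (a + b) = FRmetric nu a a + FRmetric nu b b.
Proof.
move=> ab0; rewrite FRmetricDl !FRmetricDr ab0 [FRmetric nu b a]FRmetricC ab0.
by rewrite addr0 add0r.
Qed.

Lemma FRmetric_cauchy nu v w : pos_orthant R X nu ->
  FRmetric nu v w <= FRnorm nu v * FRnorm nu w.
Proof.
move=> nu0; rewrite /FRnorm -sqrtrM ?FRmetric_ge0//.
have [v0|v0] := eqVneq (FRmetric nu v v) 0.
  rewrite (FRmetric_eq0 nu0 v0) -[X in FRmetric _ X w](scale0r 0).
  by rewrite FRmetricZl mul0r sqrtr_ge0.
have {v0} : 0 < FRmetric nu v v by rewrite lt_neqAle eq_sym v0 FRmetric_ge0.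
have := FRmetric_ge0 (FRmetric nu v v *: w - FRmetric nu v w *: v) nu0.
rewrite FRmetricBl !FRmetricBr !FRmetricZl ![FRmetric nu _ (_ *: _)]FRmetricC.
rewrite !FRmetricZl [FRmetric nu w v]FRmetricC.
set A := FRmetric nu v v; set B := FRmetric nu v w; set C := FRmetric nu w w.
move=> h A0; have : B ^+ 2 <= A * C.
  rewrite -subr_ge0 -(pmulr_rge0 _ A0); apply: le_trans h _; rewrite le_eqVlt.
  by apply/orP; left; apply/eqP; ring.
move=> /ler_wsqrtr; rewrite sqrtr_sqr; apply: le_trans; exact: ler_norm.
Qed.

Lemma FRnorm_sqr nu v : pos_orthant R X nu -> FRnorm nu v ^+ 2 = FRmetric nu v v.
Proof. by move=> nu0; rewrite sqr_sqrtr// FRmetric_ge0. Qed.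

(** Replacing the unconstrained gradient by its orthogonal projection G onto U
    can only shorten the distance to a point of U. *)
Lemma projection_le_residual nu c (U : {vspace vec R X}) G v :
  pos_orthant R X nu -> G \in U -> v \in U ->
  (forall u, u \in U -> FRmetric nu G u = dot c u) ->
  FRmetric nu (G - v) (G - v) <= FRmetric nu (v - FRsharp nu c) (v - FRsharp nu c).
Proof.
move=> nu0 GU vU GE.
have -> : v - FRsharp nu c = (G - FRsharp nu c) + - (G - v).
  by rewrite opprB [RHS]addrC addrA subrK.
have orth u : u \in U -> FRmetric nu (G - FRsharp nu c) u = 0.
  by move=> uU; rewrite FRmetricBl FRmetric_sharp// GE// subrr.
rewrite (@FRmetric_pythagoras nu (G - FRsharp nu c)); last first.
  by apply: orth; rewrite memvN memvB.
rewrite FRmetricNl [FRmetric nu _ (- _)]FRmetricC FRmetricNl opprK.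
by rewrite lerDr FRmetric_ge0.
Qed.

Section Projection.
Variables (p : nat) (A : 'M[R]_(p, #|X|)) (c nu : vec R X) (w0 : 'rV[R]_p).
Hypothesis nu0 : pos_orthant R X nu.
Hypothesis w0E : forall u, FRmetric nu (w0 *m A) (u *m A) = dot c (u *m A).

Lemma sharp_residual_orth (u : 'rV[R]_p) :
  FRmetric nu (w0 *m A - FRsharp nu c) (u *m A) = 0.
Proof. by rewrite FRmetricBl FRmetric_sharp// w0E subrr. Qed.

Lemma projection_min (w : 'rV[R]_p) :
  FRmetric nu (w0 *m A - FRsharp nu c) (w0 *m A - FRsharp nu c) <=
  FRmetric nu (w *m A - FRsharp nu c) (w *m A - FRsharp nu c).
Proof.
have -> : w *m A - FRsharp nu c = (w0 *m A - FRsharp nu c) + (w - w0) *m A.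
  by rewrite mulmxBl [RHS]addrC addrA subrK.
by rewrite (FRmetric_pythagoras (sharp_residual_orth _)) lerDl FRmetric_ge0.
Qed.

Lemma projection_norm : FRnorm nu (w0 *m A) <= FRnorm nu (FRsharp nu c).
Proof.
apply: ler_wsqrtr.
have -> : FRsharp nu c = - (w0 *m A - FRsharp nu c) + w0 *m A.
  by rewrite opprB subrK.
rewrite (@FRmetric_pythagoras nu (- _)); first by rewrite lerDr FRmetric_ge0.
by rewrite FRmetricNl sharp_residual_orth oppr0.
Qed.

End Projection.

End FisherRaoProjection.

(** * Logarithmic derivatives and the divergence *)

Section LogDerivative.
Context {R : realType} {X : finType}.

Lemma differentiable_ln_entry (V : normedModType R) (g : V -> vec R X) a x :
  differentiable g a -> 0 < entry (g a) x ->
  differentiable (fun s => ln (entry (g s) x)) a.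
Proof.
move=> dg g0.
have dc : differentiable (fun s => entry (g s) x) a.
  have := differentiable_comp dg (differentiable_coord (g a) 0 (enum_rank x)).
  exact.
have dln : differentiable (@ln R) (entry (g a) x).
  by apply/derivable1_diffP; apply: ex_derive; exact: is_derive1_ln.
exact: (differentiable_comp dc dln).
Qed.

Lemma derive_ln_entry (V : normedModType R) (g : V -> vec R X) a v x :
  differentiable g a -> 0 < entry (g a) x ->
  'D_v (fun s => ln (entry (g s) x)) a = entry ('D_v g a) x / entry (g a) x.
Proof.
move=> dg g0.
have dln : differentiable (@ln R) (entry (g a) x).
  by apply/derivable1_diffP; apply: ex_derive; exact: is_derive1_ln.
have dc : differentiable (fun w : vec R X => entry w x) (g a).
  exact: differentiable_coord.
have dgx : differentiable (fun s => entry (g s) x) a.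
  exact: (differentiable_comp dg dc).
have -> := derive_chain v dgx dln.
have -> : 'D_v (fun s => entry (g s) x) a = entry ('D_v g a) x.
  have eE (w : vec R X) : entry w x = dotr (delta_mx 0 (enum_rank x)) w.
    rewrite /dotr /dot (bigD1 (enum_rank x))//= big1 => [|i ix].
      by rewrite mxE !eqxx mulr1 addr0.
    by rewrite mxE (negPf ix) andbF mulr0.
  rewrite (_ : (fun s => entry (g s) x) = dotr (delta_mx 0 (enum_rank x)) \o g).
    by rewrite derive_dotr_comp// eE.
  by apply/funext => s /=; exact: eE.
set r := entry ('D_v g a) x; rewrite deriveE//.
have -> : 'd (@ln R) (entry (g a) x) r = r *: 'd (@ln R) (entry (g a) x) 1.
  by rewrite -linearZ /= [_%:A]mulr1.
by rewrite -deriveE//; have [_ ->] := is_derive1_ln g0.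
Qed.

(** By the chain rule w . grad (log mu_x) is the entry (w A)_x / mu_x, so the
    weighted squares are those of the Fisher-Rao form. *)
Lemma error_residual p (mu : 'rV[R]_p -> vec R X) th (w : 'rV[R]_p) (c : vec R X) :
  differentiable mu th -> pos_orthant R X (mu th) ->
  expect (mu th) (fun x =>
    (dot w (grad (fun th => ln (entry (mu th) x)) th) - entry c x) ^+ 2) =
  FRmetric (mu th) (w *m jacobian mu th - FRsharp (mu th) c)
    (w *m jacobian mu th - FRsharp (mu th) c).
Proof.
move=> dmu mu0; apply: eq_bigr => x _.
have dotC n (u v : 'rV[R]_n) : dot u v = dot v u.
  by apply: eq_bigr => i _; rewrite mulrC.
rewrite dotC -derive_dot_grad; last exact: differentiable_ln_entry.
rewrite derive_ln_entry// deriveEjacobian// entryB.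
rewrite [entry (FRsharp _ _) x]mxE -/(entry c x) -/(entry (mu th) x).
have := mu0 x; set m := entry _ x => m0; set a := entry (w *m _) x.
by field; rewrite gt_eqF.
Qed.

(** Entries with m_x = 0 contribute nothing, and the others split as
    m_x (log m_x - log g_x). *)
Lemma is_derive_KL (g : R -> vec R X) (m : vec R X) t :
  orthant R X m -> (forall s, pos_orthant R X (g s)) -> derivable g t 1 ->
  is_derive t 1 (fun s => KL m (g s)) (- FRmetric (g t) m (derive1 g t)).
Proof.
move=> m0 g0 dg.
have dg' : differentiable g t by exact/derivable1_diffP.
have KLE s : KL m (g s) =
    \sum_(i < #|X|) m 0 i * (ln (m 0 i) - ln (entry (g s) (enum_val i))).
  rewrite /KL -sum_entry; apply: eq_bigr => x _.
  rewrite enum_rankK -/(entry m x).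
  have [->|mx] := eqVneq (entry m x) 0; first by rewrite !mul0r.
  by rewrite ln_div// posrE; [rewrite lt_neqAle eq_sym mx; exact: m0|exact: g0].
rewrite (_ : (fun s => KL m (g s)) = \sum_(i < #|X|)
   (fun s => m 0 i * (ln (m 0 i) - ln (entry (g s) (enum_val i))))); last first.
  by apply/funext => s; rewrite fct_sumE KLE.
rewrite FRmetricE -sumrN; apply: is_derive_sum => i.
have dl : is_derive t 1 (fun s => ln (entry (g s) (enum_val i)))
    (derive1 g t 0 i / g t 0 i).
  apply: DeriveDef.
    by apply/derivable1_diffP; apply: differentiable_ln_entry => //; exact: g0.
  rewrite derive_ln_entry//; last exact: g0.
  by rewrite -derive1E /entry enum_valK.
have H := is_deriveZ (m 0 i) (is_deriveB (is_derive_cst (ln (m 0 i)) t 1) dl).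
suff <- : m 0 i *: (0 - derive1 g t 0 i / g t 0 i) =
    - (m 0 i * derive1 g t 0 i / g t 0 i) by exact: H.
by rewrite sub0r scalerN -mulrA.
Qed.

End LogDerivative.

(** * The natural gradient at one point *)

Section NaturalGradientPointwise.
Context {R : realType} {X : finType}.
Implicit Types (nu m c G V : vec R X).

Lemma fisherE p (mu : 'rV[R]_p -> vec R X) th : differentiable mu th ->
  fisher mu th = jacobian mu th *m FRdiag (mu th) *m (jacobian mu th)^T.
Proof.
move=> dmu; apply/matrixP => i j.
rewrite mxE !deriveEjacobian// FRmetric_mx trmx_mul trmx_delta !mulmxA -colE.
by rewrite -!mulmxA -rowE [LHS]mxE [LHS]mxE !mulmxA.
Qed.

Lemma natural_gradientE p (mu : 'rV[R]_p -> vec R X) f th :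
  differentiable mu th -> differentiable f (mu th) ->
  let A := jacobian mu th in
  natural_gradient mu f th =
    grad f (mu th) *m A^T *m (mp_pinv (A *m FRdiag (mu th) *m A^T))^T.
Proof. by move=> dmu df A; rewrite /natural_gradient fisherE// grad_comp. Qed.

Lemma chi2E m nu : pos_orthant R X nu ->
  chi2 m nu = FRmetric nu (m - nu) (m - nu).
Proof.
move=> nu0; apply: eq_bigr => x _; rewrite entryB; have := nu0 x.
by move=> ?; field; rewrite gt_eqF.
Qed.

Lemma FRmetric_self nu V : pos_orthant R X nu ->
  FRmetric nu nu V = \sum_x entry V x.
Proof.
by move=> nu0; apply: eq_bigr => x _; rewrite mulrAC mulfV ?mul1r// gt_eqF.
Qed.

(** Along a velocity V the divergence to m decreases at rate g(m - nu, V),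
    since V has total mass zero. Were V the gradient G, that rate would be the
    directional derivative of f towards m, which concavity bounds below by the
    gap in value; the defect is controlled by Cauchy-Schwarz. *)
Lemma divergence_rate (f : vec R X -> R) (U : {vspace vec R X}) m nu G V :
  pos_orthant R X nu ->
  (forall v, v \in U -> \sum_x entry v x = 0) ->
  (forall v, v \in U -> FRmetric nu G v = dot (grad f nu) v) ->
  V \in U -> m - nu \in U ->
  f m - f nu <= dot (grad f nu) (m - nu) ->
  - FRmetric nu m V <=
    - (f m - f nu) + FRnorm nu (G - V) * Num.sqrt (chi2 m nu).
Proof.
move=> nu0 U0 GE VU mU fc.
have -> : FRmetric nu m V = FRmetric nu (m - nu) V.
  by rewrite FRmetricBl FRmetric_self// U0// subr0.
have -> : FRmetric nu (m - nu) V =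
    FRmetric nu G (m - nu) - FRmetric nu (G - V) (m - nu).
  by rewrite [FRmetric nu (G - V) _]FRmetricBl subKr FRmetricC.
have := FRmetric_cauchy (G - V) (m - nu) nu0.
rewrite {2}/FRnorm -chi2E// GE// => h.
by rewrite opprB; lra.
Qed.

Lemma divergence_rate_bound (U : {vspace vec R X}) m nu V :
  pos_orthant R X nu -> (forall v, v \in U -> \sum_x entry v x = 0) ->
  V \in U ->
  `|FRmetric nu m V| <= Num.sqrt (chi2 m nu) * FRnorm nu V.
Proof.
move=> nu0 U0 VU.
have -> : FRmetric nu m V = FRmetric nu (m - nu) V.
  by rewrite FRmetricBl FRmetric_self// U0// subr0.
rewrite chi2E// -/(FRnorm nu (m - nu)) ler_norml FRmetric_cauchy// andbT.
rewrite lerNl -FRmetricNl; apply: le_trans (FRmetric_cauchy _ _ nu0) _.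
by rewrite /FRnorm FRmetricNl FRmetricC FRmetricNl opprK.
Qed.

(** The tangent at nu lies above f at both shifted points, which bounds its slope
    along the i-th coordinate from both sides. *)
Lemma concave_grad_entry_bound (f : vec R X -> R) nu i h (B : R) :
  concave_on (orthant R X) f -> differentiable f nu -> orthant R X nu ->
  0 < h -> orthant R X (nu + h *: delta_mx 0 i) ->
  orthant R X (nu - h *: delta_mx 0 i) ->
  `|f nu| <= B -> `|f (nu + h *: delta_mx 0 i)| <= B ->
  `|f (nu - h *: delta_mx 0 i)| <= B ->
  `|grad f nu 0 i| <= (B + B) / h.
Proof.
move=> fc df onu h0 op om.
have dotE a : dot (grad f nu) (a *: delta_mx 0 i) = a * grad f nu 0 i.
  rewrite /dot (bigD1 i)//= big1 => [|j ji].
    by rewrite !mxE !eqxx mulr1 addr0 mulrC.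
  by rewrite !mxE (negPf ji) andbF !mulr0.
have := concave_le_grad fc onu op df; rewrite [_ + _ - nu]addrAC subrr add0r dotE.
have := concave_le_grad fc onu om df; rewrite [_ - _ - nu]addrAC subrr add0r.
rewrite -scaleNr dotE scaleNr.
rewrite !ler_norml => h1 h2 /andP[? ?] /andP[? ?] /andP[? ?].
by rewrite ler_pdivlMr// -mulNr ler_pdivrMr//; apply/andP; split; lra.
Qed.

End NaturalGradientPointwise.

(** * Continuity and boundedness along a path *)

Section Paths.
Context {R : realType} {X : finType}.

Lemma flow_right_continuous n (b : 'rV[R]_n -> 'rV[R]_n) theta :
  flow_solution b theta -> theta h @[h --> 0^'+] --> theta 0.
Proof.
move=> [_ d0].
have : theta 0 + h *: (h^-1 *: (theta h - theta 0)) @[h --> 0^'+] -->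
    theta 0 + 0 *: b (theta 0).
  apply: cvgD; first exact: cvg_cst.
  apply: cvgZ; last exact: d0.
  by apply: cvg_at_right_filter; exact: cvg_id.
rewrite scale0r addr0; apply: cvg_trans; apply: near_eq_cvg.
near=> h.
have h0 : 0 < h by near: h; exact: nbhs_right_gt.
by rewrite scalerA mulfV ?gt_eqF// scale1r subrKC.
Unshelve. all: by end_near. Qed.

(** Freezing a path at negative times turns one-sided continuity at 0 into
    continuity on the whole line. *)
Lemma frozen_continuous (V : normedModType R) (theta : R -> V) :
  (forall t, 0 < t -> {for t, continuous theta}) ->
  theta h @[h --> 0^'+] --> theta 0 ->
  continuous (fun s : R => theta (Num.max 0 s)).
Proof.
move=> ct c0 /= s; rewrite /continuous_at.
have [s0|s0|<-] := ltgtP (0 : R) s.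
- apply: cvg_trans (ct _ s0).
  apply: near_eq_cvg; near=> h; rewrite (max_idPr _)//.
  by apply/ltW; near: h; exact: lt_nbhsr.
- apply: cvg_near_cst.
  near=> h; rewrite (max_idPl _)//.
  by apply/ltW; near: h; exact: lt_nbhsl.
- have m0 : Num.max 0 0 = 0 :> R by exact: maxxx.
  rewrite -[X in _ --> theta X]m0; apply/left_right_continuousP.
  rewrite m0; split.
    apply: cvg_near_cst; near=> h; rewrite (max_idPl _)//.
  apply: cvg_trans c0; apply: near_eq_cvg; near=> h; rewrite (max_idPr _)//.
Unshelve. all: by end_near. Qed.

Lemma continuous_bounded_segment (h : R -> R) (a b : R) : a <= b ->
  continuous h -> exists B, forall s, s \in `[a, b] -> `|h s| <= B.
Proof.
move=> ab ch.
have [||c _ hc] := @EVT_max R (fun s => `|h s|) a b => //.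
  apply: continuous_subspaceT => s.
  apply: (@continuous_comp _ _ _ h (fun r => `|r|)); first exact: ch.
  exact: norm_continuous.
by exists `|h c|.
Qed.

Section Path.
Variable gam : R -> vec R X.
Hypothesis gam_cont : continuous gam.
Hypothesis gam_pos : forall s, pos_orthant R X (gam s).

Lemma entry_continuous x : continuous (fun s => entry (gam s) x).
Proof.
move=> s; apply: (@continuous_comp _ _ _ gam (fun w : vec R X => entry w x)).
  exact: gam_cont.
exact: coord_continuous.
Qed.

Lemma chi2_continuous m : continuous (fun s => chi2 m (gam s)).
Proof.
move=> s; rewrite /continuous_at /chi2 /expect.
apply: (@cvg_big _ _ +%R 0); first exact: add_continuous.
move=> x _; have c := @entry_continuous x s.
have g0 := gam_pos s x.
apply: cvgM; first exact: c.
apply: cvgM; last first.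
  by apply: cvgV; [rewrite expf_neq0// gt_eqF|apply: cvgM; exact: c].
by apply: cvgM; apply: cvgB; [exact: cvg_cst|exact: c|exact: cvg_cst|exact: c].
Qed.

Lemma KL_continuous m : orthant R X m -> continuous (fun s => KL m (gam s)).
Proof.
move=> m0 s; rewrite /continuous_at /KL.
apply: (@cvg_big _ _ +%R 0); first exact: add_continuous.
move=> x _; have c := @entry_continuous x s.
have g0 := gam_pos s x.
have [->|mx] := eqVneq (entry m x) 0.
  rewrite mul0r; under eq_fun do rewrite mul0r; exact: cvg_cst.
have {}mx : 0 < entry m x by rewrite lt_neqAle eq_sym mx; exact: m0.
apply: cvgM; first exact: cvg_cst.
apply: (@continuous_comp _ _ _ (fun s => entry m x / entry (gam s) x) (@ln R)).
  by apply: cvgM; [exact: cvg_cst|apply: cvgV; [rewrite gt_eqF|exact: c]].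
by apply: continuous_ln; rewrite divr_gt0.
Qed.

(** On a compact time interval each entry of the path stays above some 2h > 0,
    so the path shifted by h along a coordinate remains in the open orthant,
    where f is continuous and hence bounded. *)
Lemma grad_bounded_along (f : vec R X -> R) T : 0 <= T ->
  concave_on (orthant R X) f ->
  (forall nu, pos_orthant R X nu -> differentiable f nu) ->
  exists2 C, 0 <= C &
    forall s i, s \in `[0, T] -> `|grad f (gam s) 0 i| <= C.
Proof.
move=> T0 fc df.
have bound_i i : exists C, forall s, s \in `[0, T] -> `|grad f (gam s) 0 i| <= C.
  have [||c _ hc] := @EVT_min R (fun s => gam s 0 i) 0 T => //.
    apply: continuous_subspaceT => s.
    have := @entry_continuous (enum_val i) s; rewrite /entry enum_valK; exact.
  pose h := gam c 0 i / 2.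
  have h0 : 0 < h by rewrite divr_gt0// pos_orthantE.
  have posN s : s \in `[0, T] ->
      pos_orthant R X (gam s - h *: delta_mx 0 i).
    move=> sT x; rewrite entryB entryZ /entry mxE.
    have := gam_pos s x; rewrite /entry.
    have [xi|] := eqVneq (enum_rank x) i; last by rewrite mulr0 subr0.
    rewrite xi mulr1 => _; have := hc s sT; rewrite /h.
    by have := pos_orthantE (gam_pos c) i; lra.
  have posD s : pos_orthant R X (gam s + h *: delta_mx 0 i).
    move=> x; rewrite entryD entryZ ltr_pwDl ?gam_pos//.
    by rewrite mulr_ge0 ?(ltW h0)// /entry mxE; case: (_ && _).
  have cf (g : R -> vec R X) : continuous g -> (forall s, pos_orthant R X (g s)) ->
      continuous (f \o g).
    move=> cg g0 s; apply: continuous_comp; first exact: cg.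
    exact/differentiable_continuous/df.
  have cs a : continuous (fun s => gam s + a *: delta_mx 0 i).
    by move=> s; apply: cvgD; [exact: gam_cont|exact: cvg_cst].
  have [B0 hB0] := continuous_bounded_segment T0 (cf _ gam_cont gam_pos).
  have [B1 hB1] := continuous_bounded_segment T0 (cf _ (cs h) posD).
  (* the path is clamped to the segment, outside of which the shift by -h may
     leave the orthant *)
  pose clamp s := Num.max 0 (Num.min s T).
  have clampE s : s \in `[0, T] -> clamp s = s.
    by rewrite in_itv/= => /andP[s0 sT]; rewrite /clamp (min_idPl sT) (max_idPr s0).
  have clampT s : clamp s \in `[0, T].
    by rewrite in_itv/= /clamp le_max lexx/= ge_max T0 ge_min lexx orbT.
  have cclamp : continuous clamp.
    move=> s; apply: (@continuous_max _ _ (cst 0) (fun s => Num.min s T)).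
      exact: cvg_cst.
    by apply: (@continuous_min _ _ id (cst T)); [exact: cvg_id|exact: cvg_cst].
  have cN : continuous (fun s => gam (clamp s) - h *: delta_mx 0 i).
    move=> s; apply: cvgB; last exact: cvg_cst.
    by apply: (@continuous_comp _ _ _ clamp gam); [exact: cclamp|exact: gam_cont].
  have [B2 hB2] := continuous_bounded_segment T0
    (cf _ cN (fun s => posN _ (clampT s))).
  exists ((Num.max B0 (Num.max B1 B2) + Num.max B0 (Num.max B1 B2)) / h) => s sT.
  have orth w : pos_orthant R X w -> orthant R X w by move=> w0 x; exact/ltW/w0.
  apply: concave_grad_entry_bound => //.
  - exact/df/gam_pos.
  - exact/orth/gam_pos.
  - exact/orth/posD.
  - exact/orth/posN.
  - by rewrite !le_max hB0.
  - by rewrite !le_max hB1// orbT.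
  - by have := hB2 s sT; rewrite /= clampE// !le_max => ->; rewrite !orbT.
have /choice[C hC] := bound_i.
exists (\sum_i `|C i|); first by apply: sumr_ge0.
move=> s i sT; apply: le_trans (hC i s sT) _; apply: le_trans (ler_norm _) _.
by rewrite (bigD1 i)//= lerDl sumr_ge0.
Qed.

End Path.

Lemma FRnorm_sharp_le (nu c : vec R X) (C : R) :
  simplex R X nu -> pos_orthant R X nu -> 0 <= C ->
  (forall i, `|c 0 i| <= C) -> FRnorm nu (FRsharp nu c) <= C.
Proof.
move=> [_ nu1] nu0 C0 hC; rewrite -[leRHS](ger0_norm C0) -sqrtr_sqr.
apply: ler_wsqrtr; rewrite FRmetric_sharp//.
have nu1' : \sum_i nu 0 i = 1 by rewrite -(sum_entry (fun i => nu 0 i)) -[RHS]nu1.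
rewrite -[leRHS]mul1r -nu1' mulr_suml; apply: ler_sum => i _.
rewrite mxE mulrCA ler_wpM2l//; first exact/ltW/pos_orthantE.
by rewrite -expr2 -real_normK ?num_real// lerXn2r// ?nnegrE// hC.
Qed.

End Paths.

(** * Convergence of natural gradient flows *)

Theorem corollary4p7 (R : realType) (X : finType) (p : nat)
    (L P : set (vec R X)) (hL : affine_space L) (hP : P = simplex R X `&` L)
    (hpos : P `&` pos_orthant R X !=set0)
    (mu : 'rV[R]_p -> vec R X)
    (mu_relint : forall theta, relint P (mu theta))
    (mu_diff : forall theta : 'rV[R]_p, differentiable mu theta)
    (f : vec R X -> R)
    (f_cont : {within orthant R X, continuous f})
    (f_concave : concave_on (orthant R X) f)
    (f_diff : forall nu, pos_orthant R X nu -> differentiable f nu)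
    (mustar : vec R X) (fstar : R)
    (mustar_P : P mustar) (mustar_max : forall nu, P nu -> f nu <= f mustar)
    (fstar_def : fstar = f mustar)
    (theta : R -> 'rV[R]_p)
    (theta_flow : flow_solution (natural_gradient mu f) theta) :
  let mut := fun t : R => mu (theta t) in
  let delta := fun t : R => Num.sqrt (chi2 mustar (mut t)) in
  let epsilon := fun t : R =>
    FRnorm (mut t) (FRgrad P f (mut t) - derive1 mut t) in
  let error := fun (t : R) (w : 'rV[R]_p) =>
    expect (mut t) (fun x =>
      (dot w (grad (fun th => ln (entry (mu th) x)) (theta t))
       - entry (grad f (mut t)) x) ^+ 2) in
  forall t : R, 0 < t ->
    fstar - f (mut t) <=
      (KL mustar (mut 0) - KL mustar (mut t)) / t
      + t^-1 * \int[lebesgue_measure]_(s in `[0, t]) (epsilon s * delta s)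
    /\ exists w0, (forall w, error t w0 <= error t w) /\
                  epsilon t ^+ 2 <= error t w0.
Proof.
move=> mut delta epsilon error t t0.
have [q [Pq q0]] := hpos.
have [U [U0 hullP]] := affine_hull_polytope hL hP Pq q0.
have linP := linear_part_polytope hullP.
have Psimplex nu : P nu -> simplex R X nu by rewrite hP => -[].
have Porth : P `<=` orthant R X by move=> nu /Psimplex[].
have muP th : P (mu th) /\ pos_orthant R X (mu th).
  exact: (relint_pos Porth q0 hullP).
have mupos th : pos_orthant R X (mu th) by have [] := muP th.
have PU nu nu' : P nu -> P nu' -> nu - nu' \in U.
  move=> Pnu Pnu'; rewrite -(subrKA q) -[X in _ + X]opprB.
  by apply: memvB; apply/hullP => B _; exact.
have df th : differentiable f (mu th) by exact/f_diff/mupos.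
pose c th := grad f (mu th); pose A th := jacobian mu th.
pose w th := natural_gradient mu f th; pose V th := w th *m A th.
have wE th u : FRmetric (mu th) (w th *m A th) (u *m A th) = dot (c th) (u *m A th).
  by rewrite /w natural_gradientE//; exact: gram_pinv_projection.
have VU th : V th \in U.
  rewrite /V /A -deriveEjacobian//; apply: derive_in_subspace => // x y.
  by apply: PU; exact: (muP _).1.
have GP th := @FRgradP _ _ P U f _ linP (mupos th).
have dtheta (s : R) : 0 < s -> differentiable theta s /\ 'D_1 theta s = w (theta s).
  move=> s0; have [dth Eth] := theta_flow.1 s s0.
  by split => //; exact/derivable1_diffP.
have dmut (s : R) : 0 < s -> derivable mut s 1 /\ derive1 mut s = V (theta s).
  move=> s0; have [dth Eth] := dtheta s s0; split.
    exact/derivable1_diffP/differentiable_comp.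
  by rewrite derive1E derive_chain// Eth deriveEjacobian.
have errorE (s : R) (u : 'rV[R]_p) : error s u =
    FRmetric (mut s) (u *m A (theta s) - FRsharp (mut s) (c (theta s)))
      (u *m A (theta s) - FRsharp (mut s) (c (theta s))).
  exact: error_residual.
have eps_le (s : R) : 0 < s -> epsilon s ^+ 2 <= error s (w (theta s)).
  move=> s0; rewrite /epsilon FRnorm_sqr; last exact: mupos.
  rewrite errorE (dmut s s0).2.
  have [GU GE] := GP (theta s).
  exact: (projection_le_residual (mupos _) GU (VU _) GE).
have err_min (s : R) u : error s (w (theta s)) <= error s u.
  by rewrite !errorE; exact: (projection_min (mupos _) (wE _)).
split; last by exists (w (theta t)); split=> [u|]; [exact: err_min|exact: eps_le].
(* comparison of the minimal error with the error of the direction 0 *)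
have eps_sharp (s : R) : 0 < s ->
    epsilon s <= FRnorm (mut s) (FRsharp (mut s) (c (theta s))).
  move=> s0; rewrite -(ler_pXn2r (n := 2))// ?nnegrE ?sqrtr_ge0//.
  rewrite [leRHS]FRnorm_sqr; last exact: mupos.
  apply: le_trans (eps_le s s0) _; apply: le_trans (err_min s 0) _.
  rewrite errorE mul0mx sub0r FRmetricNl FRmetricC FRmetricNl opprK.
  exact: lexx.
have fgap th : f mustar - f (mu th) <= dot (c th) (mustar - mu th).
  apply: (concave_le_grad f_concave); last exact: df.
    exact/Porth/(muP th).1.
  exact: Porth.
have KLrate (s : R) : 0 < s -> - FRmetric (mut s) mustar (V (theta s)) <=
    - (fstar - f (mut s)) + epsilon s * delta s.
  move=> s0; rewrite fstar_def /epsilon (dmut s s0).2.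
  apply: (@divergence_rate _ _ f U) => //.
  - exact: mupos.
  - by have [] := GP (theta s).
  - by apply: PU => //; exact: (muP _).1.
  - exact: fgap.
have KLderive (s : R) : 0 < s -> is_derive s 1 (fun r => KL mustar (mut r))
    (- FRmetric (mut s) mustar (V (theta s))).
  move=> s0; rewrite -(dmut s s0).2; apply: is_derive_KL.
  - exact: Porth.
  - by move=> r; exact: mupos.
  - exact: (dmut s s0).1.
have f_incr (s : R) : 0 < s -> s <= t -> f (mut s) <= f (mut t).
  move=> s0 st.
  have dfm (r : R) : 0 < r -> derivable (f \o mut) r 1 /\ 0 <= derive1 (f \o mut) r.
    move=> r0; have [/derivable1_diffP dm Em] := dmut r r0; split.
      by apply/derivable1_diffP/differentiable_comp => //; exact: df.
    rewrite derive1E derive_chain//; last exact: df.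
    rewrite -derive1E Em derive_dot_grad; last exact: df.
    by rewrite -/(c (theta r)) -wE FRmetric_ge0//; exact: mupos.
  apply: (@ger0_derive1_ndecr R (f \o mut) s t) => //.
  - move=> r; rewrite in_itv/= => /andP[sr _].
    by have [] := dfm r (lt_trans s0 sr).
  - move=> r; rewrite in_itv/= => /andP[sr _].
    by have [] := dfm r (lt_trans s0 sr).
  - apply: derivable_within_continuous => r; rewrite in_itv/= => /andP[sr _].
    by have [] := dfm r (lt_le_trans s0 sr).
(* nothing is known of theta at negative times, so the path is frozen there *)
pose gam (s : R) := mu (theta (Num.max 0 s)).
have gamE (s : R) : 0 <= s -> gam s = mut s by move=> s0; rewrite /gam (max_idPr s0).
have gam_cont : continuous gam.
  move=> s; apply: (@continuous_comp _ _ _ (fun s : R => theta (Num.max 0 s)) mu).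
    apply: frozen_continuous; last exact: flow_right_continuous theta_flow.
    move=> r r0; apply: differentiable_continuous.
    exact: (dtheta r r0).1.
  exact: differentiable_continuous.
have gam_pos s : pos_orthant R X (gam s) by exact: mupos.
have T0 : 0 <= t + 1 by rewrite addr_ge0// ltW.
have [C C0 hC] := grad_bounded_along gam_cont gam_pos T0 f_concave f_diff.
have [D hD] := continuous_bounded_segment T0 (@chi2_continuous _ _ _ gam_cont gam_pos mustar).
have sharpC (s : R) : 0 < s < t + 1 ->
    FRnorm (mut s) (FRsharp (mut s) (c (theta s))) <= C.
  move=> /andP[s0 st]; apply: FRnorm_sharp_le => //.
  - exact/Psimplex/(muP _).1.
  - exact: mupos.
  - move=> i; have := hC s i; rewrite gamE ?(ltW s0)//; apply.
    by rewrite in_itv/= !ltW.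
have deltaD (s : R) : 0 < s < t + 1 -> delta s <= Num.sqrt D.
  move=> /andP[s0 st]; apply: ler_wsqrtr; rewrite -gamE ?(ltW s0)//.
  by apply: le_trans (ler_norm _) _; apply: hD; rewrite in_itv/= !ltW.
have gap0 : 0 <= fstar - f (mut t).
  by rewrite fstar_def subr_ge0; apply: mustar_max; exact: (muP _).1.
(* by f_incr the gap at time t is a lower bound of all earlier gaps, so adding
   its linear growth keeps the derivative below epsilon * delta *)
pose phi (s : R) := KL mustar (mut s) + (fstar - f (mut t)) * s.
have dphi (s : R) : 0 < s -> is_derive s 1 phi
    (- FRmetric (mut s) mustar (V (theta s)) + (fstar - f (mut t))).
  move=> s0; have h1 := KLderive s s0.
  have h2 := is_deriveZ (fstar - f (mut t)) (is_derive_id s (1 : R)).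
  have := is_deriveD h1 h2.
  by rewrite [_%:A]mulr1; exact.
have phiE (s : R) : 0 < s -> derive1 phi s =
    - FRmetric (mut s) mustar (V (theta s)) + (fstar - f (mut t)).
  by move=> s0; rewrite derive1E; have [_ ->] := dphi s s0.
pose M := Num.sqrt D * C + (fstar - f (mut t)).
have incr : phi t - phi 0 <=
    \int[lebesgue_measure]_(s in `[0, t]) (epsilon s * delta s).
  apply: (@increment_le_integral _ _ _ _ M) => //.
  - rewrite /phi; apply: cvgD; last first.
      apply: cvgM; first exact: cvg_cst.
      by apply: cvg_at_right_filter; exact: cvg_id.
    have := @KL_continuous _ _ _ gam_cont gam_pos _ (Porth _ mustar_P) 0.
    move=> /cvg_at_right_filter; rewrite gamE// => h; apply: cvg_trans h.
    apply: near_eq_cvg; near=> s; rewrite gamE//.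
  - by move=> s s0; have [] := dphi s s0.
  - move=> s sT; have /andP[s0 _] := sT; rewrite phiE//.
    apply: le_trans (ler_normD _ _) _; rewrite normrN (ger0_norm gap0) lerD2r.
    apply: le_trans (divergence_rate_bound _ (mupos _) U0 (VU _)) _.
    apply: ler_pM; rewrite ?sqrtr_ge0//; first exact: deltaD.
    by apply: le_trans (sharpC s sT); apply: projection_norm.
  - by move=> s; rewrite mulr_ge0 ?sqrtr_ge0.
  - move=> s /andP[s0 st]; rewrite phiE//; have := KLrate s s0.
    by have := f_incr s s0 st; lra.
  - move=> s /andP[s0 st]; have sT : 0 < s < t + 1 by rewrite s0/=; lra.
    apply: (@le_trans _ _ (Num.sqrt D * C)); last by rewrite lerDl.
    rewrite mulrC; apply: ler_pM; rewrite ?sqrtr_ge0//; first exact: deltaD.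
    exact: le_trans (eps_sharp s s0) (sharpC s sT).
rewrite [leRHS](_ : _ = (KL mustar (mut 0) - KL mustar (mut t) +
  \int[lebesgue_measure]_(s in `[0, t]) (epsilon s * delta s)) / t); last first.
  by rewrite [RHS]mulrDl; congr (_ + _); exact: mulrC.
by rewrite ler_pdivlMr//; move: incr; rewrite /phi mulr0 addr0; lra.
Unshelve. all: by end_near. Qed.
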